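(* Let $A$ be a pictorsion ring. Then $A$ is a good ring.
   Context: All rings are commutative and unital; $A^\times$ denotes the unit group of $A$. A ring $A$ is a pictorsion ring if for every ring $B$ which is finite over $A$ (i.e. an $A$-algebra that is finitely generated as an $A$-module), the Picard group $\operatorname{Pic}(B)$ is a torsion group. A point $(a,b)\in A^2$ is primitive if $aA+bA=A$; a primitive point $(a,b)$ is a good point if there are an integer $N\ge 1$ and $\lambda\in A$ with $b^N+\lambda a\in A^\times$. The ring $A$ is a good ring if every primitive point in $A^2$ is a good point. *)

(* Defs.v *)
From HB Require Import structures.
From mathcomp Require Import all_boot all_algebra boolp.

Set Implicit Arguments.
Unset Strict Implicit.
Unset Printing Implicit Defensive.

Import GRing.Theory.
Local Open Scope ring_scope.
Local Open Scope quotient_scope.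

(* [comPzRingType] includes the zero ring, unlike [comNzRingType].             *)

Definition is_unit (A : comPzRingType) (x : A) : Prop := exists y : A, x * y = 1.

Section Tensor.
Variable B : comPzRingType.

(* [{bilinear _ -> _ -> _}] of sesquilinear.v requires a nontrivial ring.     *)
Definition bilin (M N P : lmodType B) (f : M -> N -> P) : Prop :=
  (forall x, linear (f x)) /\ (forall y, linear (f ^~ y)).

Section Construction.
Variables M N : lmodType B.

Definition tsum (P : lmodType B) (f : M -> N -> P) (s : seq (M * N)) : P :=
  \sum_(p <- s) f p.1 p.2.

(* A list [:: (x_1, y_1); ...; (x_k, y_k)] is a formal sum of the x_i (x) y_i; *)
(* two formal sums give the same element of M (x) N if and only if no bilinear *)
(* map separates them. That the quotient has the universal property of the     *)
(* tensor product is proved in [pure_bilin], [tlift_linear], [tliftE] and      *)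
(* [tensor_ext].                                                               *)
Definition teq (s t : seq (M * N)) : bool :=
  `[< forall (P : lmodType B) (f : M -> N -> P),
        bilin f -> tsum f s = tsum f t >].

Lemma teq_refl : reflexive teq.
Proof. by move=> s; apply/asboolP. Qed.

Lemma teq_sym : symmetric teq.
Proof.
by move=> s t; apply/asboolP/asboolP => h P f hf; rewrite h.
Qed.

Lemma teq_trans : transitive teq.
Proof.
move=> t s u /asboolP h1 /asboolP h2; apply/asboolP => P f hf.
by rewrite h1 // h2.
Qed.

Definition teq_equiv := EquivRel teq teq_refl teq_sym teq_trans.

Definition tensor := {eq_quot teq_equiv}.
HB.instance Definition _ := Choice.on tensor.

Definition tadd (u v : tensor) : tensor := \pi_tensor (repr u ++ repr v).
Definition tscale (a : B) (u : tensor) : tensor :=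
  \pi_tensor [seq (a *: p.1, p.2) | p <- repr u].
Definition tzero : tensor := \pi_tensor [::].
Definition topp (u : tensor) : tensor := tscale (-1) u.

Definition pure (x : M) (y : N) : tensor := \pi_tensor [:: (x, y)].

Definition tlift (P : lmodType B) (f : M -> N -> P) (u : tensor) : P :=
  tsum f (repr u).

Lemma tlift_pi (P : lmodType B) (f : M -> N -> P) s :
  bilin f -> tlift f (\pi_tensor s) = tsum f s.
Proof.
move=> hf; rewrite /tlift; case: piP => t /eqmodP /asboolP h.
by rewrite [RHS]h.
Qed.

Lemma tensorP (u v : tensor) :
  (forall (P : lmodType B) (f : M -> N -> P), bilin f ->
     tlift f u = tlift f v) -> u = v.
Proof.
move=> h; rewrite -[u]reprK -[v]reprK; apply/eqmodP/asboolP => P f hf.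
exact: h.
Qed.

Section Lift.
Variables (P : lmodType B) (f : M -> N -> P) (hf : bilin f).

Lemma bilinDl x x' y : f (x + x') y = f x y + f x' y.
Proof. by have := hf.2 y 1 x x'; rewrite !scale1r. Qed.
Lemma bilinDr x y y' : f x (y + y') = f x y + f x y'.
Proof. by have := hf.1 x 1 y y'; rewrite !scale1r. Qed.
Lemma bilin0l y : f 0 y = 0.
Proof. by apply: (addrI (f 0 y)); rewrite -bilinDl !addr0. Qed.
Lemma bilin0r x : f x 0 = 0.
Proof. by apply: (addrI (f x 0)); rewrite -bilinDr !addr0. Qed.
Lemma bilinZl a x y : f (a *: x) y = a *: f x y.
Proof. by have := hf.2 y a x 0; rewrite !addr0 bilin0l addr0. Qed.
Lemma bilinZr a x y : f x (a *: y) = a *: f x y.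
Proof. by have := hf.1 x a y 0; rewrite !addr0 bilin0r addr0. Qed.

Lemma tliftD u v : tlift f (tadd u v) = tlift f u + tlift f v.
Proof. by rewrite tlift_pi // /tsum big_cat. Qed.

Lemma tliftZ a u : tlift f (tscale a u) = a *: tlift f u.
Proof.
rewrite tlift_pi // /tsum big_map scaler_sumr.
by apply: eq_bigr => p _; rewrite bilinZl.
Qed.

Lemma tlift0 : tlift f tzero = 0.
Proof. by rewrite tlift_pi // /tsum big_nil. Qed.

Lemma tlift_pure x y : tlift f (pure x y) = f x y.
Proof. by rewrite tlift_pi // /tsum big_seq1. Qed.
End Lift.

Lemma taddA : associative tadd.
Proof. by move=> u v w; apply: tensorP => P f hf; rewrite !tliftD // addrA. Qed.
Lemma taddC : commutative tadd.
Proof. by move=> u v; apply: tensorP => P f hf; rewrite !tliftD // addrC. Qed.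
Lemma tadd0 : left_id tzero tadd.
Proof. by move=> u; apply: tensorP => P f hf; rewrite tliftD // tlift0 // add0r. Qed.
Lemma taddN : left_inverse tzero topp tadd.
Proof.
move=> u; apply: tensorP => P f hf.
by rewrite tliftD // tlift0 // tliftZ // scaleN1r addNr.
Qed.
HB.instance Definition _ :=
  GRing.isZmodule.Build tensor taddA taddC tadd0 taddN.

Lemma tscaleA a b v : tscale a (tscale b v) = tscale (a * b) v.
Proof. by apply: tensorP => P f hf; rewrite !tliftZ // scalerA. Qed.
Lemma tscale1 : left_id 1 tscale.
Proof. by move=> u; apply: tensorP => P f hf; rewrite tliftZ // scale1r. Qed.
Lemma tscaleDr : right_distributive tscale +%R.
Proof.
move=> a u v; apply: tensorP => P f hf.
by rewrite !(tliftZ, tliftD) // scalerDr.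
Qed.
Lemma tscaleDl v : {morph tscale^~ v : a b / a + b}.
Proof.
move=> a b; apply: tensorP => P f hf.
by rewrite !(tliftZ, tliftD) // scalerDl.
Qed.
HB.instance Definition _ :=
  GRing.Zmodule_isLmodule.Build B tensor tscaleA tscale1 tscaleDr tscaleDl.

End Construction.

Section UniversalProperty.
Variables M N : lmodType B.

Lemma pure_bilin : bilin (@pure M N).
Proof.
split=> [x a y y'|y a x x']; apply: tensorP => P f hf.
  rewrite [RHS]tliftD // [X in _ = X + _]tliftZ // !tlift_pure //.
  by rewrite bilinDr // bilinZr.
rewrite [RHS]tliftD // [X in _ = X + _]tliftZ // !tlift_pure //.
by rewrite bilinDl // bilinZl.
Qed.

Lemma tlift_linear (P : lmodType B) (f : M -> N -> P) :
  bilin f -> linear (tlift f).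
Proof. by move=> hf a u v; rewrite tliftD // tliftZ. Qed.

Lemma tliftE (P : lmodType B) (f : M -> N -> P) :
  bilin f -> forall x y, tlift f (pure x y) = f x y.
Proof. exact: tlift_pure. Qed.

Lemma tensor_sum (u : tensor M N) :
  u = \sum_(p <- repr u) pure p.1 p.2.
Proof.
have tliftS (P : lmodType B) (f : M -> N -> P) (s : seq (M * N)) : bilin f ->
    tlift f (\sum_(p <- s) pure p.1 p.2) = tsum f s.
  move=> hf; elim: s => [|p s IH]; first by rewrite /tsum !big_nil tlift0.
  by rewrite /tsum !big_cons tliftD // IH tlift_pure.
by apply: tensorP => P f hf; rewrite tliftS.
Qed.

Lemma tensor_ext (P : lmodType B) (g h : tensor M N -> P) :
  linear g -> linear h -> (forall x y, g (pure x y) = h (pure x y)) -> g =1 h.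
Proof.
move=> lg lh e u.
pose G : {linear tensor M N -> P} :=
  HB.pack g (GRing.isLinear.Build _ _ _ _ g lg).
pose H : {linear tensor M N -> P} :=
  HB.pack h (GRing.isLinear.Build _ _ _ _ h lh).
rewrite -[g]/(G : _ -> _) -[h]/(H : _ -> _) (tensor_sum u) !raddf_sum.
by apply: eq_bigr => p _; exact: e.
Qed.

End UniversalProperty.

Definition isom (M N : lmodType B) : Prop :=
  exists f : {linear M -> N}, bijective f.

Lemma isom_intro (M N : lmodType B) (f : M -> N) (g : N -> M) :
  linear f -> cancel f g -> cancel g f -> isom M N.
Proof.
move=> lf fK gK.
exists (HB.pack f (GRing.isLinear.Build _ _ _ _ f lf) : {linear M -> N}).
by exists g.
Qed.

Lemma isom_elim (M N : lmodType B) : isom M N ->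
  exists (f : {linear M -> N}) (g : N -> M),
    [/\ linear g, cancel f g & cancel g f].
Proof.
move=> [f [g fK gK]]; exists f, g; split=> // a u v.
by apply: (can_inj fK); rewrite gK linearP !gK.
Qed.

Lemma isom_refl M : isom M M.
Proof. by apply: (@isom_intro _ _ id id). Qed.

Lemma isom_sym M N : isom M N -> isom N M.
Proof. by move=> /isom_elim [f [g [lg fK gK]]]; apply: (isom_intro lg gK fK). Qed.

Lemma isom_trans N M P : isom M N -> isom N P -> isom M P.
Proof.
move=> [f bf] [g bg]; exists (g \o f : {linear M -> P}); exact: bij_comp.
Qed.

Lemma isom_tensor M M' N N' :
  isom M M' -> isom N N' -> isom (tensor M N) (tensor M' N').
Proof.
move=> /isom_elim [f [f' [lf' fK f'K]]] /isom_elim [g [g' [lg' gK g'K]]].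
have pD := pure_bilin.
pose F x y := pure (f x) (g y); pose F' x y := pure (f' x) (g' y).
have hF : bilin F.
  by split=> [x a y y'|y a x x']; rewrite /F linearP ?(pD _ _).1 ?(pD _ _).2.
have hF' : bilin F'.
  by split=> [x a y y'|y a x x']; rewrite /F' ?lf' ?lg' ?(pD _ _).1 ?(pD _ _).2.
have lF := tlift_linear hF; have lF' := tlift_linear hF'.
apply: (isom_intro lF (g := tlift F')); apply: tensor_ext => //.
- by move=> a u v; rewrite lF lF'.
- by move=> x y; rewrite !tliftE // /F' fK gK.
- by move=> a u v; rewrite lF' lF.
- by move=> x y; rewrite !tliftE // /F f'K g'K.
Qed.

Lemma tensorC_isom M N : isom (tensor M N) (tensor N M).
Proof.
have h (M' N' : lmodType B) : bilin (fun (x : M') (y : N') => pure y x).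
  by split=> [x|y]; [apply: (pure_bilin _ _).2 | apply: (pure_bilin _ _).1].
apply: (isom_intro (tlift_linear (h M N)) (g := tlift (fun y x => pure x y)));
  apply: tensor_ext => // [a u v|x y];
  by rewrite ?(tliftE (h _ _)) // !(tlift_linear (h _ _)).
Qed.

Lemma tensor1_isom M : isom (tensor M B^o) M.
Proof.
pose f (x : M) (b : B^o) : M := (b : B) *: x.
have hf : bilin f.
  split=> [x a b b'|b a x x']; rewrite /f ?scalerDl ?scalerDr //.
    by rewrite -scalerA.
  by rewrite !scalerA mulrC.
have lf := tlift_linear hf.
have lp : linear (fun x : M => pure x (1 : B^o)) by apply: (pure_bilin _ _).2.
apply: (isom_intro lf (g := fun x => pure x (1 : B^o))).
  apply: tensor_ext => // [a u v|x b]; first by rewrite lf lp.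
  rewrite tliftE // /f (bilinZl (pure_bilin _ _)) -(bilinZr (pure_bilin _ _)).
  by congr pure; exact: mulr1.
by move=> x; rewrite tliftE // /f scale1r.
Qed.

Lemma tensorA_isom M N P :
  isom (tensor (tensor M N) P) (tensor M (tensor N P)).
Proof.
have pD := pure_bilin.
pose a1 z (x : M) (y : N) := pure x (pure y z : tensor N P).
have h1 z : bilin (a1 z).
  split=> [x a y y'|y a x x']; rewrite /a1; last by rewrite (pD _ _).2.
  by rewrite (pD _ _).2 (pD _ _).1.
pose f (t : tensor M N) (z : P) := tlift (a1 z) t.
have hf : bilin f.
  split=> [t a z z'|z]; last exact: tlift_linear.
  rewrite /f /tlift /tsum scaler_sumr -big_split /=; apply: eq_bigr => p _.
  by rewrite /a1 !(pD _ _).1.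
pose a2 x (y : N) (z : P) := pure (pure x y : tensor M N) z.
have h2 x : bilin (a2 x).
  split=> [y a z z'|z a y y']; rewrite /a2; first by rewrite (pD _ _).1.
  by rewrite (pD _ _).1 (pD _ _).2.
pose g (x : M) (t : tensor N P) := tlift (a2 x) t.
have hg : bilin g.
  split=> [x|t a x x']; first exact: tlift_linear.
  rewrite /g /tlift /tsum scaler_sumr -big_split /=; apply: eq_bigr => p _.
  by rewrite /a2 !(pD _ _).2.
have lf := tlift_linear hf; have lg := tlift_linear hg.
have fp x y z : tlift f (pure (pure x y) z) = pure x (pure y z).
  by rewrite tliftE // /f tliftE.
have gp x y z : tlift g (pure x (pure y z)) = pure (pure x y) z.
  by rewrite tliftE // /g tliftE.
apply: (isom_intro lf (g := tlift g)).
  apply: tensor_ext => // [a u v|t z]; first by rewrite lf lg.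
  move: t; apply: tensor_ext => [a u v|a u v|x y].
  - by rewrite (pD _ _).2 lf lg.
  - by rewrite (pD _ _).2.
  - by rewrite fp gp.
apply: tensor_ext => // [a u v|x t]; first by rewrite lg lf.
move: t; apply: tensor_ext => [a u v|a u v|y z].
- by rewrite (pD _ _).1 lg lf.
- by rewrite (pD _ _).1.
- by rewrite gp fp.
Qed.

End Tensor.

Section Pic.
Variable B : comPzRingType.
Implicit Types L M N : lmodType B.

Definition invertible L : Prop := exists N, isom (tensor L N) B^o.

Lemma invertible1 : invertible B^o.
Proof. by exists B^o; exact: tensor1_isom. Qed.

Lemma tensorACA_isom L L' N N' :
  isom (tensor (tensor L L') (tensor N N'))
       (tensor (tensor L N) (tensor L' N')).
Proof.
apply: isom_trans (tensorA_isom _ _ _) _.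
apply: isom_trans (isom_sym (tensorA_isom _ _ _)).
apply: isom_tensor (isom_refl _) _.
apply: isom_trans (isom_sym (tensorA_isom _ _ _)) _.
apply: isom_trans (tensorA_isom _ _ _).
exact: isom_tensor (tensorC_isom _ _) (isom_refl _).
Qed.

Lemma invertibleM L L' : invertible L -> invertible L' ->
  invertible (tensor L L').
Proof.
move=> [N hN] [N' hN']; exists (tensor N N').
apply: isom_trans (tensorACA_isom _ _ _ _) _.
exact: isom_trans (isom_tensor hN hN') (tensor1_isom _).
Qed.

(* An element of Pic(B) is an isomorphism class of invertible B-modules,      *)
(* represented by its membership predicate.                                   *)
Record Pic := MkPic {
  pic_mem : lmodType B -> Prop;
  pic_memP : exists L, invertible L /\ pic_mem = isom L }.

Lemma isom_eqP L M : isom L M <-> isom L = isom M.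
Proof.
split=> [h|->]; last exact: isom_refl.
apply/funext => N; apply/propext; split; apply: isom_trans => //.
exact: isom_sym.
Qed.

Lemma pic_eq (x y : Pic) : pic_mem x = pic_mem y -> x = y.
Proof.
case: x y => [C hC] [D hD] /= e; subst D; congr MkPic; exact: Prop_irrelevance.
Qed.

Definition pic_of L (hL : invertible L) : Pic :=
  MkPic (ex_intro _ L (conj hL erefl)).

Lemma pic_classP (x : Pic) : exists L (hL : invertible L), x = pic_of hL.
Proof.
have [L [hL e]] := pic_memP x; exists L, hL; exact: pic_eq.
Qed.

Lemma pic_of_eqP L M (hL : invertible L) (hM : invertible M) :
  pic_of hL = pic_of hM <-> isom L M.
Proof.
split=> [e|/isom_eqP e]; last exact: pic_eq.
by apply/isom_eqP; have /= := congr1 (fun x => pic_mem x) e.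
Qed.

Definition pic_one : Pic := pic_of invertible1.

Definition pic_mul_mem (x y : Pic) : lmodType B -> Prop := fun P =>
  exists L M, [/\ pic_mem x L, pic_mem y M & isom (tensor L M) P].

Lemma pic_mul_subproof (x y : Pic) :
  exists L, invertible L /\ pic_mul_mem x y = isom L.
Proof.
have [L [hL eL]] := pic_memP x; have [M [hM eM]] := pic_memP y.
exists (tensor L M); split; first exact: invertibleM.
apply/funext => P; apply/propext; rewrite /pic_mul_mem eL eM.
split=> [[L' [M' [hL' hM']]]|hP]; first exact/isom_trans/isom_tensor.
by exists L, M; split=> //; exact: isom_refl.
Qed.

Definition pic_mul (x y : Pic) : Pic := MkPic (pic_mul_subproof x y).

Lemma pic_mulE L M (hL : invertible L) (hM : invertible M) :
  pic_mul (pic_of hL) (pic_of hM) = pic_of (invertibleM hL hM).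
Proof.
apply: pic_eq; apply/funext => P; apply/propext => /=.
split=> [[L' [M' [hL' hM']]]|hP]; first exact/isom_trans/isom_tensor.
by exists L, M; split=> //; exact: isom_refl.
Qed.

Lemma pic_mulA : associative pic_mul.
Proof.
move=> x y z; have [L [hL ->]] := pic_classP x.
have [M [hM ->]] := pic_classP y; have [N [hN ->]] := pic_classP z.
by rewrite !pic_mulE; apply/pic_of_eqP/isom_sym/tensorA_isom.
Qed.

Lemma pic_mulC : commutative pic_mul.
Proof.
move=> x y; have [L [hL ->]] := pic_classP x.
have [M [hM ->]] := pic_classP y.
by rewrite !pic_mulE; apply/pic_of_eqP/tensorC_isom.
Qed.

Lemma pic_mulx1 : right_id pic_one pic_mul.
Proof.
move=> x; have [L [hL ->]] := pic_classP x.
by rewrite pic_mulE; apply/pic_of_eqP/tensor1_isom.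
Qed.

Lemma pic_inv_ex (x : Pic) : exists y, pic_mul x y = pic_one.
Proof.
have [L [hL ->]] := pic_classP x; have [N hN] := hL.
have hN' : invertible N.
  by exists L; exact: isom_trans (tensorC_isom _ _) hN.
by exists (pic_of hN'); rewrite pic_mulE; apply/pic_of_eqP.
Qed.

Definition pic_exp (x : Pic) (n : nat) : Pic := iter n (pic_mul x) pic_one.

Definition pic_torsion : Prop :=
  forall x : Pic, exists2 n, (0 < n)%N & pic_exp x n = pic_one.

End Pic.

(* B is viewed as an A-algebra via f.                                         *)
Definition finite_over (A B : comPzRingType) (f : {rmorphism A -> B}) : Prop :=
  exists (n : nat) (e : 'I_n -> B),
    forall b : B, exists c : 'I_n -> A, b = \sum_(i < n) f (c i) * e i.

Definition pictorsion (A : comPzRingType) : Prop :=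
  forall (B : comPzRingType) (f : {rmorphism A -> B}),
    finite_over f -> pic_torsion B.

Definition primitive_point (A : comPzRingType) (a b : A) : Prop :=
  forall x : A, exists u v : A, x = a * u + b * v.

Definition good_point (A : comPzRingType) (a b : A) : Prop :=
  primitive_point a b /\
  exists (N : nat) (l : A), (1 <= N)%N /\ is_unit (b ^+ N + l * a).

Definition good_ring (A : comPzRingType) : Prop :=
  forall a b : A, primitive_point a b -> good_point a b.

(* Main.v *)
(** Let [B] be the fibre product of [A] with itself over [A/a], a finite
    [A]-algebra. By Milnor's patching, every [c] that is invertible modulo [a]
    glues two copies of [A] into an invertible [B]-module [L_c], and
    [L_c (x) L_d] is isomorphic to [L_(cd)]. As [Pic B] is torsion, some
    [L_(b^N)] with [N > 0] is free; the two coordinates [u], [v] of a generator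
    are units of [A] with [v = b^N u] modulo [a], so [v/u = b^N + l a] for
    some [l]. *)

Require Import Defs.
From HB Require Import structures.
From mathcomp Require Import all_boot all_algebra boolp ring.

Set Implicit Arguments.
Unset Strict Implicit.
Unset Printing Implicit Defensive.

Import GRing.Theory.
Local Open Scope ring_scope.

Section Glueing.
Variables (A : comPzRingType) (a : A).
Implicit Types (c d e s : A).

(** Milnor's gluing of two copies of [A] along multiplication by [c] on [A/a], expressed without
    forming the quotient; [glue 1] is the fibre product. *)
Definition glue c : {pred A * A} :=
  fun p => `[< exists t, p.2 = c * p.1 + a * t >].

Lemma glueP c (p : A * A) :
  reflect (exists t, p.2 = c * p.1 + a * t) (p \in glue c).
Proof. exact: asboolP. Qed.

(** The slack [s] lets [e] be any representative of [c * d] modulo [a]. This one closure property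
    serves the ring structure, the action on lines, the product of lines and its inverse. *)
Lemma glueM c d e s p q : c * d = e + a * s ->
  p \in glue c -> q \in glue d -> p * q \in glue e.
Proof.
move=> cd /glueP[t pt] /glueP[t' qt]; apply/glueP.
exists (s * p.1 * q.1 + c * p.1 * t' + t * d * q.1 + a * t * t').
rewrite /= pt qt.
have -> : (c * p.1 + a * t) * (d * q.1 + a * t') =
  (c * d) * (p.1 * q.1) + a * (c * p.1 * t' + t * d * q.1 + a * t * t') by ring.
rewrite cd; ring.
Qed.

Lemma glue_zmod_closed c : zmod_closed (glue c).
Proof.
split=> [|p q /glueP[t pt] /glueP[t' qt]]; apply/glueP.
  by exists 0; rewrite /= !mulr0 addr0.
by exists (t - t'); rewrite /= pt qt; ring.
Qed.

Lemma glue1_subring_closed : subring_closed (glue 1).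
Proof.
split=> [|p q|p q]; first by apply/glueP; exists 0; rewrite /= mulr1 mulr0 addr0.
  exact: (glue_zmod_closed 1).2.
by apply: (@glueM _ _ _ 0); rewrite mulr1 mulr0 addr0.
Qed.

Record double := Double { double_val :> A * A; _ : double_val \in glue 1 }.
HB.instance Definition _ := [isSub for double_val].
HB.instance Definition _ := [Choice of double by <:].
HB.instance Definition _ :=
  GRing.SubChoice_isSubComPzRing.Build (A * A)%type (glue 1) double
    glue1_subring_closed.

Record line c := Line { line_val :> A * A; _ : line_val \in glue c }.
HB.instance Definition _ c := [isSub for @line_val c].
HB.instance Definition _ c := [Choice of line c by <:].
HB.instance Definition _ c :=
  GRing.SubChoice_isSubZmodule.Build (A * A)%type (glue c) (line c)
    (glue_zmod_closed c).

Lemma line_scale_subproof c (r : double) (p : line c) :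
  val r * val p \in glue c.
Proof.
by apply: (@glueM 1 c c 0) (valP r) (valP p); rewrite mul1r mulr0 addr0.
Qed.
Definition line_scale c (r : double) (p : line c) : line c :=
  Line (line_scale_subproof r p).

Lemma line_scaleA c r r' (p : line c) :
  line_scale r (line_scale r' p) = line_scale (r * r') p.
Proof. by apply: val_inj; rewrite /= mulrA. Qed.
Lemma line_scale1 c : left_id 1 (@line_scale c).
Proof. by move=> p; apply: val_inj; rewrite /= mul1r. Qed.
Lemma line_scaleDr c : right_distributive (@line_scale c) +%R.
Proof. by move=> r p q; apply: val_inj; rewrite /= mulrDr. Qed.
Lemma line_scaleDl c (p : line c) : {morph (@line_scale c)^~ p : r r' / r + r'}.
Proof. by move=> r r'; apply: val_inj; rewrite /= mulrDl. Qed.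
HB.instance Definition _ c := GRing.Zmodule_isLmodule.Build double (line c)
  (@line_scaleA c) (@line_scale1 c) (@line_scaleDr c) (@line_scaleDl c).

Lemma line1_isom : isom (line 1) double^o.
Proof.
pose f (p : line 1) : double^o := Double (valP p).
pose g (r : double^o) : line 1 := Line (valP (r : double)).
by apply: (@isom_intro _ _ _ f g) => [r p q|p|r]; apply: val_inj.
Qed.

(* If [d] has inverse [d'] modulo [a], then [1] is a sum of products of
   elements of [glue d] and [glue d']; this gives the inverse of the
   multiplication map [line c (x) line d -> line e]. *)
Lemma line_tensor c d e d' s s' : c * d = e + a * s -> d * d' = 1 + a * s' ->
  isom (tensor (line c) (line d)) (line e).
Proof.
move=> cd dd'.
pose mul (p : line c) (q : line d) : line e :=
  Line (glueM cd (valP p) (valP q)).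
have mul_bilin : bilin mul.
  split=> [p r q q'|q r p p']; apply: val_inj => /=.
    by rewrite mulrDr mulrCA.
  by rewrite mulrDl mulrA.
(* The product [(1, d') * (1, d)] is 1 up to an error [a * s'] in the second coordinate; the product
   [(d, 1) * (0, - (a * s'))] cancels that error. *)
have x1P : ((1, d) : A * A) \in glue d by apply/glueP; exists 0 => /=; ring.
have x2P : ((0, - (a * s')) : A * A) \in glue d.
  by apply/glueP; exists (- s') => /=; ring.
have y1P : ((1, d') : A * A) \in glue d' by apply/glueP; exists 0 => /=; ring.
have y2P : ((d, 1) : A * A) \in glue d'.
  by apply/glueP; exists (- s') => /=; rewrite mulrC dd'; ring.
pose x1 : line d := Line x1P; pose x2 : line d := Line x2P.
have xy : (1, d') * val x1 + (d, 1) * val x2 = 1 :> A * A.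
  by congr pair => /=; [ring | rewrite [d' * d]mulrC dd'; ring].
(* Hence multiplication by an element of [glue d'] carries [line e] back to [line c]. *)
have ed' : e * d' = c + a * (c * s' - s * d').
  have -> : e = c * d - a * s by rewrite cd; ring.
  have -> : (c * d - a * s) * d' = c * (d * d') - a * s * d' by ring.
  by rewrite dd'; ring.
pose div y (yP : y \in glue d') (z : line e) : line c :=
  Line (glueM ed' (valP z) yP).
pose g z : tensor (line c) (line d) := pure (div _ y1P z) x1 + pure (div _ y2P z) x2.
have pD := pure_bilin (line c) (line d).
have g_lin : linear g.
  have div_lin y (yP : y \in glue d') : linear (div y yP).
    by move=> r z z'; apply: val_inj; rewrite /= mulrDl mulrA.
  by move=> r z z'; rewrite /g !div_lin !pD.2 scalerDr addrACA.
apply: (isom_intro (tlift_linear mul_bilin) (g := g)).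
  apply: tensor_ext => // [r u v|p q].
    by rewrite (tlift_linear mul_bilin) g_lin.
  rewrite tliftE // /g.
  (* The product of [q] with an element of [glue d'] lies in [glue 1], so it is a scalar and can
     cross the tensor sign. *)
  pose r y (yP : y \in glue d') : double := Double (glueM dd' (valP q) yP).
  have divE y (yP : y \in glue d') : div y yP (mul p q) = r y yP *: p.
    by apply: val_inj; rewrite /= [RHS]mulrC mulrA.
  rewrite !divE !(bilinZl pD) -!(bilinZr pD) -(bilinDr pD); congr pure.
  by apply: val_inj; rewrite /= -!mulrA -mulrDr [X in _ * X]xy mulr1.
move=> z; rewrite /g (tliftD mul_bilin) !tliftE //; apply: val_inj.
by rewrite /= -!mulrA -mulrDr [X in _ * X]xy mulr1.
Qed.

Lemma line_invertible c c' s : c * c' = 1 + a * s -> invertible (line c).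
Proof.
move=> cc'; exists (line c'); apply: isom_trans line1_isom.
by apply: (line_tensor cc' (d' := c) (s' := s)); rewrite mulrC.
Qed.

(** Each induction step tensors with [line c] on the right, so [line_tensor] only needs the inverse
    of [c] itself modulo [a]. *)
Lemma pic_exp_line c c' s (hc : invertible (line c)) n :
  c * c' = 1 + a * s ->
  exists hcn : invertible (line (c ^+ n)), pic_exp (pic_of hc) n = pic_of hcn.
Proof.
move=> cc'; elim: n => [|n [hcn IH]].
  have h1 : invertible (line (c ^+ 0)).
    by apply: (@line_invertible _ 1 0); rewrite expr0; ring.
  by exists h1; apply/pic_of_eqP/isom_sym/line1_isom.
have tE : isom (tensor (line (c ^+ n)) (line c)) (line (c ^+ n.+1)).
  by apply: (line_tensor (s := 0) _ cc'); rewrite exprSr; ring.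
have hn : invertible (line (c ^+ n.+1)).
  have [N hN] := invertibleM hcn hc; exists N.
  exact: isom_trans (isom_tensor (isom_sym tE) (isom_refl _)) hN.
exists hn; rewrite /pic_exp iterS -/(pic_exp _ n) IH pic_mulC pic_mulE.
exact/pic_of_eqP.
Qed.

(** Both coordinates of a generator are units, because the line contains [(1, c)] and [(c', 1)],
    each with a coordinate equal to 1. *)
Lemma line_free_unit c c' s : c * c' = 1 + a * s ->
  isom double^o (line c) -> exists l, is_unit (c + l * a).
Proof.
move=> cc' /isom_elim [f [g [_ _ gK]]].
have gen p : val p = val (g p : double) * val (f 1).
  have gp1 : (g p : double) *: (1 : double^o) = g p by exact: mulr1.
  by rewrite -{1}[p]gK -[in LHS]gp1 linearZ.
have [t] := glueP _ _ (valP (f 1)); case: (val (f 1)) gen => u v /= gen vE.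
have p1P : ((1, c) : A * A) \in glue c by apply/glueP; exists 0 => /=; ring.
have p2P : ((c', 1) : A * A) \in glue c.
  by apply/glueP; exists (- s) => /=; rewrite cc'; ring.
have /(congr1 fst) /= u1 := gen (Line p1P).
have /(congr1 snd) /= v1 := gen (Line p2P).
move: u1 v1; set u' := fst _; set v' := snd _ => u1 v1.
(* Here [u'] and [v'] are the inverses of [u] and [v], so the unit is [v / u] and its inverse is
   [u / v]. *)
exists (u' * t), (v' * u).
have -> : c + u' * t * a = u' * v.
  by rewrite vE mulrDr mulrCA -u1; ring.
have -> : u' * v * (v' * u) = (u' * u) * (v' * v) by ring.
by rewrite -u1 -v1 mulr1.
Qed.

Lemma diag_subproof (x : A) : ((x, x) : A * A) \in glue 1.
Proof. by apply/glueP; exists 0 => /=; ring. Qed.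
Definition diag (x : A) : double := Double (diag_subproof x).

Lemma diag_is_additive : zmod_morphism diag.
Proof. by move=> x y; apply: val_inj. Qed.
Lemma diag_is_multiplicative : monoid_morphism diag.
Proof. by split=> [|x y]; apply: val_inj. Qed.
HB.instance Definition _ :=
  GRing.isZmodMorphism.Build A double diag diag_is_additive.
HB.instance Definition _ :=
  GRing.isMonoidMorphism.Build A double diag diag_is_multiplicative.

(** The elements 1 and [(0, a)] span, as [(x, x + a * t)] has coefficients [x] and [t]. *)
Lemma double_finite : finite_over diag.
Proof.
have aP : ((0, a) : A * A) \in glue 1 by apply/glueP; exists 1 => /=; ring.
exists 2, (fun i => if i == 0 then 1 else Double aP) => r.
have [t rt] := glueP _ _ (valP r).
exists (fun i => if i == 0 then (val r).1 else t).
apply: val_inj; rewrite !big_ord_recl big_ord0 /=.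
by rewrite [LHS]surjective_pairing rt; congr pair => /=; ring.
Qed.

End Glueing.

Theorem corollary3p1 (A : comPzRingType) (hA : pictorsion A) : good_ring A.
Proof.
move=> a b hab; split=> //; have [u [v uv]] := hab 1.
have bv : b * v = 1 + a * - u by rewrite uv; ring.
have hb := line_invertible bv.
have [N N0 hN] := hA _ (@diag A a) (double_finite a) (pic_of hb).
have [hbN bNE] := pic_exp_line hb N bv.
(* To apply [line_free_unit] to [b ^+ N], its own inverse modulo [a] is required. *)
have bvN : exists s, b ^+ N * v ^+ N = 1 + a * s.
  elim: N {N0 hN hbN bNE} => [|n [s IH]]; first by exists 0; rewrite !expr0; ring.
  exists (s - u - a * u * s); rewrite !exprS.
  have -> : b * b ^+ n * (v * v ^+ n) = (b * v) * (b ^+ n * v ^+ n) by ring.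
  by rewrite bv IH; ring.
have [s bNv] := bvN.
have [|l hl] := line_free_unit bNv; last by exists N, l.
by apply/(pic_of_eqP (@invertible1 _) hbN); rewrite -bNE hN.
Qed.
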